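(* Let $(G,\star)$ be a log-Euclidean Lie group, let $H$ be a closed connected subgroup of $G$, and let $\pi:G\to G/H$ be the quotient map. A smooth section $\sigma:G/H\to G$ of $\pi$ is a Lie group homomorphism if and only if $G$ splits as an internal direct product $G=K\times H$, where $K:=\sigma(G/H)$.
   Context: A log-Euclidean Lie group is a smooth manifold $G$ with a diffeomorphism $\log_G:G\to\mathfrak g$ onto a finite-dimensional real vector space $\mathfrak g$, equipped with the commutative Lie group law $u\star v=\log_G^{-1}(\log_G(u)+\log_G(v))$. $G/H$ carries its standard quotient Lie group structure. A smooth section of $\pi$ is a smooth map $\sigma:G/H\to G$ with $\pi\circ\sigma=\mathrm{id}_{G/H}$. ''$G=K\times H$ as an internal direct product'' means that $K$ and $H$ are (normal) subgroups of $G$ with $K\cap H=\{e_G\}$ and $K\star H=G$. *)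

(* Defs.v *)
From HB Require Import structures.
From mathcomp Require Import all_boot all_order all_algebra.
From mathcomp Require Import all_classical all_reals all_analysis.

Set Implicit Arguments.
Unset Strict Implicit.
Unset Printing Implicit Defensive.

Import Order.TTheory GRing.Theory Num.Theory numFieldNormedType.Exports.

Local Open Scope classical_set_scope.
Local Open Scope ring_scope.

(* f is C^infinity on A (meant for A open): every iterated directional
   derivative of f, of any order and in any directions, is Frechet
   differentiable at every point of A. *)
Definition smooth_on (R : realType) (m n : nat) (A : set 'rV[R]_m)
    (f : 'rV[R]_m -> 'rV[R]_n) : Prop :=
  forall (vs : seq 'rV[R]_m) (x : 'rV[R]_m), A x ->
    differentiable (foldr (fun v g => 'D_v g) f vs) x.

(* The values of chart_fun outside chart_dom, and of chart_inv outside
   chart_fun @` chart_dom, are irrelevant. *)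
Record chart (R : realType) (M : topologicalType) (n : nat) := Chart {
  chart_dom : set M ;
  chart_fun :> M -> 'rV[R]_n ;
  chart_inv : 'rV[R]_n -> M ;
  chart_dom_open : open chart_dom ;
  chart_img_open : open (chart_fun @` chart_dom) ;
  chart_invK : forall x, chart_dom x -> chart_inv (chart_fun x) = x ;
  chart_fun_continuous : {within chart_dom, continuous chart_fun} ;
  chart_inv_continuous :
    {within chart_fun @` chart_dom, continuous chart_inv} }.

Definition smoothly_compatible (R : realType) (M : topologicalType) (n : nat)
    (phi psi : chart R M n) : Prop :=
  smooth_on (phi @` (chart_dom phi `&` chart_dom psi)) (psi \o chart_inv phi).

(* An atlas need not be maximal: two atlases present the same manifold when
   they generate the same maximal atlas, and smooth_map and submersion below
   only depend on the latter. *)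
Record smooth_structure (R : realType) (M : topologicalType) := SmoothStructure {
  mfd_dim : nat ;
  atlas : set (chart R M mfd_dim) ;
  mfd_hausdorff : hausdorff_space M ;
  mfd_second_countable : @second_countable M ;
  atlas_cover : forall x : M, exists2 phi, atlas phi & chart_dom phi x ;
  atlas_compatible :
    forall phi psi, atlas phi -> atlas psi -> smoothly_compatible phi psi }.

Arguments atlas {R M} s _ : rename.

Section maps_between_manifolds.
Variables (R : realType) (M N : topologicalType).
Variables (sM : smooth_structure R M) (sN : smooth_structure R N).

Definition smooth_map (f : M -> N) : Prop :=
  continuous f /\
  forall phi psi, atlas sM phi -> atlas sN psi ->
    smooth_on (phi @` (chart_dom phi `&` f @^-1` chart_dom psi))
              (psi \o f \o chart_inv phi).

Definition submersion (f : M -> N) : Prop :=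
  smooth_map f /\
  forall (x : M) phi psi, atlas sM phi -> atlas sN psi ->
    chart_dom phi x -> chart_dom psi (f x) ->
    forall w, exists v, 'd (psi \o f \o chart_inv phi) (phi x) v = w.

End maps_between_manifolds.

Lemma smooth_on_id (R : realType) (n : nat) (A : set 'rV[R]_n) : smooth_on A id.
Proof.
have cst_smooth (vs : seq 'rV[R]_n) (c : 'rV[R]_n) :
    exists d, foldr (fun v g => 'D_v g) (cst c : _ -> 'rV[R]_n) vs = cst d.
  elim: vs => [|v vs [d IH]] /=; first by exists c.
  by exists 0; rewrite IH; apply/funext => x; rewrite derive_cst.
move=> vs x _; case/lastP: vs => [|vs v] //=.
rewrite -cats1 foldr_cat /=.
have -> : 'D_v (id : 'rV[R]_n -> 'rV[R]_n) = cst v.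
  by apply/funext => y; rewrite derive_id.
have [d ->] := cst_smooth vs v.
exact: differentiable_cst.
Qed.

Section vector_space_manifold.
Variables (R : realType) (V : vectType R).

(* V with its canonical topology, the one for which linear coordinates V -> R^n
   (here those of the library, v2r; the choice of basis is immaterial) are
   homeomorphisms. *)
Definition vect_top := initial_topology (@VectorInternalTheory.v2r R V).
HB.instance Definition _ := Topological.on vect_top.

Let v2r : vect_top -> 'rV[R]_(dim V) := @VectorInternalTheory.v2r R V.
Let r2v : 'rV[R]_(dim V) -> vect_top := @VectorInternalTheory.r2v R V.
Let v2rK : cancel v2r r2v := VectorInternalTheory.v2rK.
Let r2vK : cancel r2v v2r := VectorInternalTheory.r2vK.

Let v2r_continuous : continuous v2r.
Proof. exact: initial_continuous. Qed.

Let r2v_continuous : continuous r2v.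
Proof.
apply/continuousP => _ [A oA <-].
rewrite -comp_preimage (_ : _ \o _ = id) ?preimage_id //.
by apply/funext => x /=; exact: r2vK.
Qed.

Lemma vect_hausdorff : hausdorff_space vect_top.
Proof.
move=> x y xy; apply: (can_inj v2rK); apply: norm_hausdorff => A B xA yB.
have [z [Az Bz]] := xy _ _ (v2r_continuous xA) (v2r_continuous yB).
by exists (v2r z).
Qed.

Lemma rV_second_countable (n : nat) : @second_countable 'rV[R]_n.
Proof.
pose b (p : 'rV[rat]_n * nat) : set 'rV[R]_n :=
  ball (map_mx (ratr : rat -> R) p.1) p.2.+1%:R^-1.
exists (range b).
  exact: card_le_trans (card_image_le _ _) (countableP _).
split=> [_ [p _ <-]|x A /nbhs_ballP [_/posnumP[e] eA]].
  by apply: ball_open; rewrite invr_gt0.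
have [N Ne] : exists N, N.+1%:R^-1 < e%:num / 2 :> R.
  by have [//|N] := @ltr_add_invr R 0 (e%:num / 2) _; rewrite add0r; exists N.
have d0 : 0 < N.+1%:R^-1 :> R by rewrite invr_gt0.
have qP (j : 'I_n) : exists q : rat, ball (x 0 j) N.+1%:R^-1 (ratr q : R).
  have /rat_in_itvoo [q] : x 0 j < x 0 j + N.+1%:R^-1 by rewrite ltrDl.
  rewrite in_itv /= => /andP[xq qx]; exists q.
  by rewrite /ball /= distrC ger0_norm ?subr_ge0 ?ltW // ltrBlDl.
have [q qE] := choice qP.
have xb : ball (\row_j (ratr (q j) : R)) N.+1%:R^-1 x.
  by split=> // i j; rewrite mxE ord1; apply: ball_sym.
have rE : map_mx (ratr : rat -> R) (\row_j q j) = \row_j (ratr (q j) : R).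
  by apply/matrixP => i j; rewrite !mxE.
exists (b (\row_j q j, N)).
  split; first by exists (\row_j q j, N).
  by rewrite /b /= rE.
move=> y; rewrite /b /= rE => yb; apply: eA.
rewrite [e%:num]splitr; apply: (@ball_triangle _ _ (\row_j (ratr (q j) : R))).
  by apply: (le_ball (ltW Ne)); apply: ball_sym.
exact: (le_ball (ltW Ne)).
Qed.

Lemma vect_second_countable : @second_countable vect_top.
Proof.
have [B cB [oB bB]] := rV_second_countable (dim V).
exists [set v2r @^-1` A | A in B].
  exact: card_le_trans (card_image_le _ _) cB.
split=> [_ [A BA <-]|x A xA]; first by exists A => //; exact: oB.
have vA : nbhs (v2r x) (r2v @^-1` A).
  by apply: r2v_continuous; rewrite v2rK.
have [C [BC Cx] CA] := bB _ _ vA.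
exists (v2r @^-1` C); first by split=> //; exists C.
by move=> y /CA /=; rewrite v2rK.
Qed.

Let vect_img : v2r @` setT = setT.
Proof. by apply/seteqP; split=> // y _; exists (r2v y); rewrite ?r2vK. Qed.

Let vect_img_open : open (v2r @` setT).
Proof. by rewrite vect_img; exact: openT. Qed.

Let v2r_within : {within setT, continuous v2r}.
Proof. exact: continuous_subspaceT v2r_continuous. Qed.

Let r2v_within : {within v2r @` setT, continuous r2v}.
Proof. exact: continuous_subspaceT r2v_continuous. Qed.

Definition vect_chart : chart R vect_top (dim V) :=
  Chart openT vect_img_open (fun x _ => v2rK x) v2r_within r2v_within.

Lemma vect_atlas_cover (x : vect_top) :
  exists2 phi, [set vect_chart] phi & chart_dom phi x.
Proof. by exists vect_chart. Qed.

Lemma vect_atlas_compatible phi psi :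
  [set vect_chart] phi -> [set vect_chart] psi -> smoothly_compatible phi psi.
Proof.
move=> -> ->; rewrite /smoothly_compatible (_ : _ \o _ = id).
  exact: smooth_on_id.
by apply/funext => x; exact: r2vK.
Qed.

Definition vect_smooth : smooth_structure R vect_top :=
  SmoothStructure vect_hausdorff vect_second_countable
    vect_atlas_cover vect_atlas_compatible.

End vector_space_manifold.

(* A manifold G with a diffeomorphism logG : G -> g, of inverse expG, whose
   group law is u * v = expG (logG u + logG v). The unit and the inverse are
   then forced: they are expG 0 and expG (- logG u). *)
HB.mixin Record isLogEuclidean (R : realType) (g : vectType R) G
    & Topological G & Group G := {
  smoothG : smooth_structure R G ;
  logG : G -> g ;
  expG : g -> G ;
  logGK : cancel logG expG ;
  expGK : cancel expG logG ;
  logG_smooth : smooth_map smoothG (vect_smooth g) logG ;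
  expG_smooth : smooth_map (vect_smooth g) smoothG expG ;
  mulG_def : forall u v : G, (u * v)%g = expG (logG u + logG v) }.

#[short(type="logEuclideanType")]
HB.structure Definition LogEuclidean (R : realType) (g : vectType R) :=
  {G of Topological G & Group G & isLogEuclidean R g G}.

Arguments smoothG {R g} G : rename.

Lemma mulGC (R : realType) (g : vectType R) (G : logEuclideanType g) (u v : G) :
  (u * v = v * u)%g.
Proof. by rewrite !mulG_def addrC. Qed.

Definition is_subgroup (G : groupType) (A : set G) : Prop :=
  group_closed [in A].

Record subgroup (G : groupType) := Subgroup {
  subgroup_set :> set G ;
  subgroupP : is_subgroup subgroup_set }.

Section quotient_group.
Variables (R : realType) (g : vectType R) (G : logEuclideanType g).
Variable H : subgroup G.
Local Open Scope group_scope.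
Local Open Scope quotient_scope.

Definition coset_rel : rel G := fun u v => u^-1 * v \in (H : set G).

Lemma coset_rel_equiv : equiv_class_of coset_rel.
Proof.
have [H1 HB] := subgroupP H; have HV := group_closedV (conj H1 HB).
have HM := group_closedM (conj H1 HB).
have VE (u v : G) : (u^-1 * v)^-1 = v^-1 * u by rewrite invgM invgK.
split=> [u|u v|v u w].
- by rewrite /coset_rel mulVg.
- by apply/idP/idP => /HV; rewrite VE.
- by move=> uv vw; have := HM _ _ uv vw; rewrite mulgA mulgK.
Qed.

Canonical coset_equiv := EquivRelPack coset_rel_equiv.

(* The set of cosets u * H, with the quotient topology. *)
Definition quotG := quotient_topology {eq_quot coset_equiv}.
HB.instance Definition _ := Topological.on quotG.
HB.instance Definition _ := Quotient.on quotG.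

Definition pi_quot (u : G) : quotG := \pi_quotG u.

Lemma pi_quotP (u v : G) :
  pi_quot u = pi_quot v <-> u^-1 * v \in (H : set G).
Proof. by split=> [/eqmodP|uv] //; apply/eqmodP. Qed.

Lemma pi_quot_repr (x : quotG) : pi_quot (repr x) = x.
Proof. exact: reprK. Qed.

Definition quot_mul (x y : quotG) : quotG := pi_quot (repr x * repr y).
Definition quot_inv (x : quotG) : quotG := pi_quot (repr x)^-1.

Let repr_pi (u : G) : (repr (pi_quot u))^-1 * u \in (H : set G).
Proof. by apply/pi_quotP; exact: pi_quot_repr. Qed.

Lemma pi_quotM (u v : G) : quot_mul (pi_quot u) (pi_quot v) = pi_quot (u * v).
Proof.
have HM := group_closedM (subgroupP H).
apply/pi_quotP; have := HM _ _ (repr_pi u) (repr_pi v).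
set a := repr _; set b := repr _; rewrite invgM.
by rewrite -!mulgA [b^-1 * v]mulGC [b^-1 * (a^-1 * _)]mulGC -!mulgA.
Qed.

Lemma pi_quotV (u : G) : quot_inv (pi_quot u) = pi_quot u^-1.
Proof.
have HV := group_closedV (subgroupP H).
apply/pi_quotP; have := HV _ (repr_pi u).
by rewrite invgM !invgK mulGC.
Qed.

Lemma quot_mulA : associative quot_mul.
Proof.
move=> x y z; rewrite -(pi_quot_repr x) -(pi_quot_repr y) -(pi_quot_repr z).
by rewrite !pi_quotM mulgA.
Qed.

Lemma quot_mul1 : left_id (pi_quot 1) quot_mul.
Proof. by move=> x; rewrite -(pi_quot_repr x) pi_quotM mul1g. Qed.

Lemma quot_1mul : right_id (pi_quot 1) quot_mul.
Proof. by move=> x; rewrite -(pi_quot_repr x) pi_quotM mulg1. Qed.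

Lemma quot_mulV : left_inverse (pi_quot 1) quot_inv quot_mul.
Proof. by move=> x; rewrite -(pi_quot_repr x) pi_quotV pi_quotM mulVg. Qed.

Lemma quot_Vmul : right_inverse (pi_quot 1) quot_inv quot_mul.
Proof. by move=> x; rewrite -(pi_quot_repr x) pi_quotV pi_quotM mulgV. Qed.

HB.instance Definition _ :=
  isGroup.Build quotG quot_mulA quot_mul1 quot_1mul quot_mulV quot_Vmul.

Lemma pi_quot_morph : {morph pi_quot : u v / u * v}.
Proof. by move=> u v; rewrite -pi_quotM. Qed.

End quotient_group.

Section sections_and_splittings.
Variables (R : realType) (g : vectType R) (G : logEuclideanType g).
Variable H : subgroup G.
Local Open Scope group_scope.

(* The standard smooth structure on G / H is the unique one for which the
   projection is a smooth submersion; the group law of G / H is smooth for it. *)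
Definition quotient_structure (Q : smooth_structure R (quotG H)) : Prop :=
  submersion (smoothG G) Q (@pi_quot R g G H).

Definition smooth_section (Q : smooth_structure R (quotG H))
    (sigma : quotG H -> G) : Prop :=
  smooth_map Q (smoothG G) sigma /\ forall x, pi_quot H (sigma x) = x.

Definition lie_group_morphism (Q : smooth_structure R (quotG H))
    (sigma : quotG H -> G) : Prop :=
  smooth_map Q (smoothG G) sigma /\ {morph sigma : x y / x * y}.

End sections_and_splittings.

Section internal_direct_products.
Variable G : groupType.
Local Open Scope group_scope.

Definition is_normal_subgroup (A : set G) : Prop :=
  is_subgroup A /\ forall u v, A u -> A (u ^ v).

Definition internal_direct_product (K H : set G) : Prop :=
  [/\ is_normal_subgroup K, is_normal_subgroup H,
      K `&` H = [set 1] & [set u * v | u in K & v in H] = [set: G]].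

End internal_direct_products.

(* Main.v *)
Require Import Defs.
From HB Require Import structures.
From mathcomp Require Import all_boot all_order all_algebra.
From mathcomp Require Import all_classical all_reals all_analysis.
Local Open Scope classical_set_scope.

(** Smoothness of [sigma] is given, so the equivalence is algebraic: do the representatives chosen
    by [sigma] multiply correctly? If they do, the range K is a subgroup meeting [H] only in 1, and
    every u is [sigma (pi_quot H u)] times an element of [H] ([morph_section_direct_product]).
    Conversely, [sigma (x * y)] and [sigma x * sigma y] lie in K and in one coset of [H], so a
    trivial intersection makes them equal ([direct_product_section_morph]). *)

Lemma morph_group1 (G1 G2 : groupType) (f : G1 -> G2) :
  {morph f : x y / (x * y)%g} -> f 1%g = 1%g.
Proof. by move=> fM; apply: (mulgI (f 1%g)); rewrite -fM !mulg1. Qed.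

Lemma morph_image_subgroup (G1 G2 : groupType) (f : G1 -> G2) :
  {morph f : x y / (x * y)%g} -> is_subgroup (range f).
Proof.
move=> fM; have f1 := morph_group1 _ _ _ fM.
have fV x : f x^-1%g = (f x)^-1%g.
  by apply: (mulgI (f x)); rewrite -fM !mulgV.
split=> [|_ _ /set_mem[x _ <-] /set_mem[y _ <-]]; apply/mem_set.
  by exists 1%g.
by exists (x * y^-1)%g; rewrite ?fM ?fV.
Qed.

(** Conjugation is trivial because the group law is commutative. *)
Lemma subgroup_normal (R : realType) (g : vectType R) (G : logEuclideanType g)
    (A : set G) :
  is_subgroup A -> is_normal_subgroup A.
Proof. by move=> sA; split=> // u v Au; rewrite conjgE mulGC mulgK. Qed.

Lemma pi_quot_eq1 (R : realType) (g : vectType R) (G : logEuclideanType g)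
    (H : subgroup G) (u : G) :
  pi_quot H u = 1%g <-> (H : set G) u.
Proof.
(* The unit of [quotG H] is, by definition, the coset of 1. *)
rewrite -[X in _ = X]/(pi_quot H 1%g).
split=> [/esym/pi_quotP|Hu]; first by rewrite invg1 mul1g => /set_mem.
by apply/esym/pi_quotP; rewrite invg1 mul1g; exact: mem_set.
Qed.

Local Open Scope group_scope.

Lemma morph_section_direct_product (R : realType) (g : vectType R)
    (G : logEuclideanType g) (H : subgroup G) (sigma : quotG H -> G) :
  cancel sigma (pi_quot H) ->
  {morph sigma : x y / x * y} -> internal_direct_product (range sigma) H.
Proof.
move=> sigmaK sM; split.
- exact/subgroup_normal/morph_image_subgroup.
- exact/subgroup_normal/subgroupP.
- have s1 := morph_group1 _ _ _ sM.
  (* If [sigma x] lies in [H], it projects both to [x] and to 1, hence equals [sigma 1]. *)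
  apply/seteqP; split=> [_ [[x _ <-] /pi_quot_eq1]|_ ->].
    by rewrite sigmaK => ->.
  by split; [exists 1 | apply/pi_quot_eq1].
- apply/seteqP; split=> // u _; exists (sigma (pi_quot H u)).
    by exists (pi_quot H u).
  exists ((sigma (pi_quot H u))^-1 * u); last by rewrite mulVKg.
  by apply/set_mem/pi_quotP; rewrite sigmaK.
Qed.

Lemma direct_product_section_morph (R : realType) (g : vectType R)
    (G : logEuclideanType g) (H : subgroup G) (sigma : quotG H -> G) :
  cancel sigma (pi_quot H) ->
  internal_direct_product (range sigma) H -> {morph sigma : x y / x * y}.
Proof.
move=> sigmaK [[sK _] _ KH _] x y.
have Ks z : sigma z \in range sigma by apply/mem_set; exists z.
(* Two elements of K in the same coset of H differ by an element of K `&` H. *)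
have : ([set 1] : set G) ((sigma (x * y))^-1 * (sigma x * sigma y)).
  rewrite -KH; split; apply: set_mem.
    by rewrite (group_closedM sK) ?(group_closedV sK) ?(group_closedM sK).
  (* Both elements project to [x * y]. *)
  by apply/pi_quotP; rewrite pi_quot_morph !sigmaK.
by move/(canRL (mulVKg _)); rewrite mulg1.
Qed.

Local Close Scope group_scope.

Theorem proposition4p10 (R : realType) (g : vectType R)
    (G : logEuclideanType g)
    (H : subgroup G)
    (H_closed : closed (H : set G)) (H_connected : connected (H : set G))
    (Q : smooth_structure R (quotG H)) (Q_quotient : quotient_structure Q)
    (sigma : quotG H -> G) (sigma_section : smooth_section Q sigma) :
  lie_group_morphism Q sigma <-> internal_direct_product (range sigma) H.
Proof.
have [sigma_smooth sigmaK] := sigma_section; split=> [[_ sM]|KH].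
  exact: morph_section_direct_product.
by split=> //; exact: direct_product_section_morph.
Qed.
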